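(* For every integer $n$, \[ \sum_{j\geq 0} p(n-4\pi_j) \equiv \begin{cases} 1 \pmod 2 & \text{if } n \text{ is a triangular number},\\ 0 \pmod 2 & \text{otherwise,}\end{cases} \] where $\pi_j = \frac38 j^2 + \frac{3-(-1)^j}{8}j + \frac{1-(-1)^j}{16}$ is the $j$th generalized pentagonal number ($\pi_0,\pi_1,\pi_2,\dots = 0,1,2,5,7,12,15,\dots$).
   Context: $p(m)$ denotes the number of partitions of $m$, with $p(0)=1$ and $p(m)=0$ for $m<0$. Triangular numbers are $k(k+1)/2$ for integers $k\geq 0$. *)

(* Defs.v *)
From mathcomp Require Import all_boot all_order all_algebra.
Set Implicit Arguments. Unset Strict Implicit. Unset Printing Implicit Defensive.
Import GRing.Theory Num.Theory.

(* Partition function: a partition of m is given by its multiplicity function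
   f, where f i is the number of parts equal to i.+1 (parts are at most m,
   and each multiplicity is at most m); p(m) = number of such f with
   \sum_i (i+1) * f i = m.  In particular p 0 = 1. *)
Definition partn (m : nat) : nat :=
  #|[set f : {ffun 'I_m -> 'I_m.+1} | \sum_(i < m) (i.+1 * f i)%N == m]|.

Definition partZ (m : int) : nat :=
  match m with Posz k => partn k | Negz _ => 0%N end.

(* Generalized pentagonal number
   pi_j = 3/8 j^2 + (3 - (-1)^j)/8 j + (1 - (-1)^j)/16,
   computed as (16 * pi_j) / 16, which is an exact division. *)
Definition gpent (j : nat) : nat :=
  (6 * j ^ 2 + 2 * (if odd j then 4 else 2) * j + (if odd j then 2 else 0)) %/ 16.

Definition triangular (n : int) : Prop :=
  exists k : nat, n = Posz (k * k.+1 %/ 2).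

(* Main.v *)
Require Import Defs.
From mathcomp Require Import all_boot all_order all_algebra.
From mathcomp Require Import zify ring.
Set Implicit Arguments.
Unset Strict Implicit.
Unset Printing Implicit Defensive.
Import GRing.Theory.
Local Open Scope ring_scope.

(** Over F_2, with E(q) = \prod_k (1 - q^k) = 1 / \sum_m p(m) q^m, Euler's
    pentagonal number theorem gives \sum_j q^(4 pi_j) = E(q^4) = E(q)^4, and
    Gauss' identity \sum_k q^(k(k+1)/2) = E(q^2)^2 / E(q) gives
    \sum_k q^(k(k+1)/2) = E(q)^3; hence
    (\sum_m p(m) q^m) (\sum_j q^(4 pi_j)) = E(q)^3 = \sum_k q^(k(k+1)/2).
    The identities of Euler and Gauss are obtained from Shanks' finite forms,
    whose successive differences telescope. *)

(** * Shanks' finite forms of the identities of Euler and Gauss *)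

Section Shanks.
Variables (R : comNzRingType) (q : R).

(** Induction on [n]: if [W s] is the summand for [n] and [V s] is [(1 - q ^+ s) * W s], the summand
    for [n.+1] is [W s + (V s.+1 - V s)]. The differences telescope, [V 0] vanishes, and the
    boundary terms supply the two new powers of [q]. *)
Lemma shanks_pentagonal (n : nat) :
  \sum_(0 <= s < n.+1) (-1) ^+ s * (\prod_(s <= i < n) (1 - q ^+ i.+1)) *
      q ^+ (s * n + 'C(s.+1, 2))
  = 1 + \sum_(0 <= t < n) (-1) ^+ t.+1 *
      (q ^+ (t.+1 * t + 'C(t.+2, 2)) + q ^+ (t.+1 * t.+1 + 'C(t.+2, 2))).
Proof.
elim: n => [|n IHn].
  by rewrite big_nat1 !big_geq //= !expr0 !mulr1 addr0.
rewrite [in RHS]big_nat_recr //= addrA -IHn.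
pose W s := (-1) ^+ s * (\prod_(s <= i < n) (1 - q ^+ i.+1)) *
  q ^+ (s * n + 'C(s.+1, 2)).
pose V s := (1 - q ^+ s) * W s.
have bS s : ('C(s.+2, 2) = 'C(s.+1, 2) + s.+1)%N by rewrite binS bin1.
have WS s : (s < n)%N -> - (W s * q ^+ (n.+1 + s)) = V s.+1.
  move=> s_lt; rewrite /V /W (big_ltn s_lt) bS.
  have -> : (s.+1 * n + ('C(s.+1, 2) + s.+1) =
             s * n + 'C(s.+1, 2) + (n.+1 + s))%N by rewrite mulSn; lia.
  by rewrite (exprD _ _ (n.+1 + s)) !exprS; ring.
have step s : (0 <= s < n)%N ->
    (-1) ^+ s * (\prod_(s <= i < n.+1) (1 - q ^+ i.+1)) *
      q ^+ (s * n.+1 + 'C(s.+1, 2)) = W s + (V s.+1 - V s).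
  move=> /andP[_ s_lt]; rewrite -WS // /V /W big_nat_recr ?(ltnW s_lt) //=.
  by rewrite mulnS !exprD; ring.
rewrite (big_nat_recr n.+1) //= (big_nat_recr n) //=.
rewrite (eq_big_nat _ _ step) big_split /= telescope_sumr //.
rewrite big_nat1 [\prod_(n.+1 <= i < n.+1) _]big_geq //.
rewrite [in RHS]big_nat_recr //= -/(W n) /V /W [\prod_(n <= i < n) _]big_geq //.
by rewrite bS expr0 !(mulnS, mulSn) !exprD !exprS; ring.
Qed.

(** Shanks' quotients are cleared by the product of all odd factors, so the identity holds in any
    commutative ring. Passing from [n] to [n.+1] multiplies [W s] by the new odd factor and adds the
    difference [U s.+1 - U s], where [U 0] is zero. *)
Lemma shanks_gauss (n : nat) :
  \sum_(0 <= s < n) (\prod_(s <= i < n) (1 - q ^+ (i.+1).*2)) *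
      (\prod_(0 <= i < s) (1 - q ^+ i.*2.+1)) * q ^+ (s * n.*2.+1)
  = (\prod_(0 <= i < n) (1 - q ^+ i.*2.+1)) *
      \sum_(0 <= s < n.*2) q ^+ 'C(s.+1, 2).
Proof.
elim: n => [|n IHn]; first by rewrite !big_geq // mulr0.
pose W s := (\prod_(s <= i < n) (1 - q ^+ (i.+1).*2)) *
      (\prod_(0 <= i < s) (1 - q ^+ i.*2.+1)) * q ^+ (s * n.*2.+1).
pose U s := (1 - q ^+ s.*2) * W s.
have bS s : ('C(s.+2, 2) = 'C(s.+1, 2) + s.+1)%N by rewrite binS bin1.
have b2 : ('C(n.*2.+1, 2) = n * n.*2.+1)%N.
  by rewrite bin2 /= -doubleMr doubleK mulnC.
have WS s : (s < n)%N -> W s * q ^+ n.*2.+1 * (1 - q ^+ s.*2.+1) = U s.+1.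
  move=> s_lt; rewrite /U /W (big_ltn s_lt) (big_nat_recr s) //= mulSn exprD.
  by ring.
have step s : (0 <= s < n)%N ->
    (\prod_(s <= i < n.+1) (1 - q ^+ (i.+1).*2)) *
      (\prod_(0 <= i < s) (1 - q ^+ i.*2.+1)) * q ^+ (s * n.+1.*2.+1) =
    (1 - q ^+ n.*2.+1) * W s + (U s.+1 - U s).
  move=> /andP[_ s_lt]; rewrite -WS // /U /W big_nat_recr ?(ltnW s_lt) //=.
  have -> : (s * n.+1.*2.+1 = s * n.*2.+1 + s.*2)%N by lia.
  by rewrite doubleS !exprD !exprS; ring.
rewrite big_nat_recr //= (eq_big_nat _ _ step) big_split /= -mulr_sumr IHn.
rewrite telescope_sumr // big_nat1 (big_nat_recr n) //= doubleS.
rewrite (big_nat_recr n.*2.+1) //= (big_nat_recr n.*2) //=.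
rewrite bS b2 /U /W [\prod_(n <= i < n) _]big_geq // double0 expr0.
have -> : (n * n.*2.+3 = n * n.*2.+1 + n.*2)%N by lia.
by rewrite !exprD !exprS; ring.
Qed.

End Shanks.

(** * Congruence modulo [X^m], replacing power series by polynomials *)

Section CongruenceModXn.
Variable R : comNzRingType.
Implicit Types p : {poly R}.

Definition congrX m p1 p2 := exists r, p1 = p2 + 'X^m * r.

Lemma congrX_refl m p : congrX m p p.
Proof. by exists 0; rewrite mulr0 addr0. Qed.

Lemma congrX_sym m p1 p2 : congrX m p1 p2 -> congrX m p2 p1.
Proof. by case=> r ->; exists (- r); ring. Qed.

Lemma congrX_trans m p1 p2 p3 :
  congrX m p1 p2 -> congrX m p2 p3 -> congrX m p1 p3.
Proof. by case=> r -> [s ->]; exists (r + s); ring. Qed.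

Lemma congrXM m p1 p2 p3 p4 :
  congrX m p1 p2 -> congrX m p3 p4 -> congrX m (p1 * p3) (p2 * p4).
Proof.
by case=> r -> [s ->]; exists (p2 * s + r * p4 + 'X^m * r * s); ring.
Qed.

Lemma congrXD m p1 p2 p3 p4 :
  congrX m p1 p2 -> congrX m p3 p4 -> congrX m (p1 + p3) (p2 + p4).
Proof. by case=> r -> [s ->]; exists (r + s); ring. Qed.

Lemma congrX_sum0 m a b (F : nat -> {poly R}) :
    (forall i, (a <= i < b)%N -> congrX m (F i) 0) ->
  congrX m (\sum_(a <= i < b) F i) 0.
Proof.
move=> F0; rewrite big_nat.
elim/big_ind: _ => [|x y xP yP|i /F0 //]; first exact: congrX_refl.
by rewrite -[0]addr0; apply: congrXD.
Qed.

Lemma congrX_prod1 m a b (F : nat -> {poly R}) :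
    (forall i, (a <= i < b)%N -> congrX m (F i) 1) ->
  congrX m (\prod_(a <= i < b) F i) 1.
Proof.
move=> F1; rewrite big_nat.
elim/big_ind: _ => [|x y xP yP|i /F1 //]; first exact: congrX_refl.
by rewrite -[1]mulr1; apply: congrXM.
Qed.

Lemma congrX_Xn0 m k : (m <= k)%N -> congrX m 'X^k 0.
Proof. by move=> mk; exists 'X^(k - m); rewrite add0r -exprD subnKC. Qed.

Lemma congrX_mulXn0 m k p : (m <= k)%N -> congrX m (p * 'X^k) 0.
Proof.
move=> mk; rewrite -[0](mulr0 p).
by apply: congrXM; [exact: congrX_refl|exact: congrX_Xn0].
Qed.

Lemma congrX_leq m n p1 p2 : (m <= n)%N -> congrX n p1 p2 -> congrX m p1 p2.
Proof.
by move=> mn [r ->]; exists ('X^(n - m) * r); rewrite mulrA -exprD subnKC.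
Qed.

Lemma congrX_coef m p1 p2 k : congrX m p1 p2 -> (k < m)%N -> p1`_k = p2`_k.
Proof. by move=> [r ->] km; rewrite coefD coefXnM km addr0. Qed.

(** * Truncated Euler product and partition generating function *)

Definition eulerp n : {poly R} := \prod_(0 <= i < n) (1 - 'X^(i.+1)).

Lemma eulerp_congr m n : (m <= n)%N -> congrX m.+1 (eulerp n) (eulerp m).
Proof.
move=> mn; rewrite /eulerp (big_cat_nat (n := m)) //= -[X in congrX _ _ X]mulr1.
apply: congrXM; first exact: congrX_refl.
apply: congrX_prod1 => i /andP[mi _].
by exists (- 'X^(i - m)); rewrite mulrN -exprD; congr (_ - 'X^_); lia.
Qed.

Definition partp n : {poly R} := \prod_(i < n) \sum_(j < n.+1) 'X^(i.+1 * j).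

(** Each geometric sum times its Euler factor is [1 - X^((i+1)(n+1))], which is 1 modulo
    [X^(n+1)]. *)
Lemma partp_eulerp n : congrX n.+1 (partp n * eulerp n) 1.
Proof.
rewrite /partp -(big_mkord xpredT (fun i => \sum_(j < n.+1) 'X^(i.+1 * j))).
rewrite /eulerp -big_split /=; apply: congrX_prod1 => i _.
have -> : (\sum_(j < n.+1) 'X^(i.+1 * j)) * (1 - 'X^(i.+1))
          = 1 - 'X^(i.+1 * n.+1) :> {poly R}.
  under eq_bigr do rewrite exprM.
  by rewrite exprM mulrC -opprB mulNr -subrX1 opprB.
exists (- 'X^(i * n.+1)); rewrite mulrN -exprD.
by congr (_ - 'X^_); rewrite mulSn.
Qed.

(** Distributing the product over the sums gives one monomial per multiplicity function; on the
    diagonal these functions have exactly the type used by [partn]. *)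
Lemma coef_partp_diag n : (partp n)`_n = (Defs.partn n)%:R.
Proof.
rewrite /partp bigA_distr_bigA /= coef_sum.
under eq_bigr do rewrite -expr_sum coefXn eq_sym.
rewrite -natr_sum /Defs.partn -sum1_card [in RHS]big_mkcond; congr _%:R.
by apply: eq_bigr => f _; rewrite inE eq_sym; case: eqP.
Qed.

Lemma coef_partp n k : (k <= n)%N -> (partp n)`_k = (Defs.partn k)%:R.
Proof.
(* Modulo [X^(k+1)], [partp n] and [partp k] both invert the same Euler product, hence agree. *)
move=> kn; rewrite -coef_partp_diag; apply: (@congrX_coef k.+1) => //.
have Pn : congrX k.+1 (partp n * eulerp n) 1.
  by apply: congrX_leq _ (partp_eulerp n); rewrite ltnS.
have PEk : congrX k.+1 (partp n * (eulerp n * partp k)) (partp n).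
  rewrite -[X in congrX _ _ X]mulr1; apply: congrXM; first exact: congrX_refl.
  rewrite mulrC; apply: congrX_trans _ (partp_eulerp k).
  by apply: congrXM; [exact: congrX_refl|exact: eulerp_congr].
apply: congrX_trans (congrX_sym PEk) _; rewrite mulrA -[X in congrX _ _ X]mul1r.
by apply: congrXM => //; exact: congrX_refl.
Qed.

(** In Shanks' sum the term [s = 0] is the product, and every later exponent is at least [n + 1]. *)
Lemma pentagonal_congr k n : (0 < k)%N ->
  congrX n.+1 (\prod_(0 <= i < n) (1 - ('X^k) ^+ i.+1))
    (1 + \sum_(0 <= t < n) (-1) ^+ t.+1 *
      (('X^k) ^+ (t.+1 * t + 'C(t.+2, 2)) +
       ('X^k) ^+ (t.+1 * t.+1 + 'C(t.+2, 2)))).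
Proof.
move=> k_gt0; rewrite -shanks_pentagonal.
rewrite [X in congrX _ _ X]big_ltn // !expr0 mul1r mulr1.
rewrite -[X in congrX _ X _]addr0; apply: congrXD; first exact: congrX_refl.
apply: congrX_sym; apply: congrX_sum0 => s /andP[s_gt0 _].
rewrite -exprM; apply: congrX_mulXn0; apply: leq_trans (leq_pmull _ k_gt0).
rewrite binS bin1 addnA -addn1 leq_add //.
by rewrite (leq_trans _ (leq_addr _ _)) ?leq_pmull.
Qed.

Lemma gauss_congr n : (0 < n)%N ->
  congrX n.*2.+1 (\prod_(0 <= i < n) (1 - 'X^(i.+1.*2)))
    ((\prod_(0 <= i < n) (1 - 'X^(i.*2.+1))) *
      \sum_(0 <= s < n.*2) 'X^('C(s.+1, 2))).
Proof.
move=> n_gt0; rewrite -shanks_gauss.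
rewrite [X in congrX _ _ X]big_ltn // [\prod_(0 <= i < 0) _]big_geq //.
rewrite mul0n expr0 !mulr1 -[X in congrX _ X _]addr0.
apply: congrXD; first exact: congrX_refl.
apply: congrX_sym; apply: congrX_sum0 => s /andP[s_gt0 _].
by apply: congrX_mulXn0; rewrite leq_pmull.
Qed.

End CongruenceModXn.

(** * Triangular and generalized pentagonal numbers *)

Lemma bin2_double s : ('C(s.+1, 2).*2 = s.+1 * s)%N.
Proof. by rewrite bin2 halfK /= oddM /=; case: (odd s); rewrite subn0. Qed.

Lemma triangularP (n : nat) : triangular n <-> exists s, n = 'C(s.+1, 2).
Proof.
have E s : (s * s.+1 %/ 2 = 'C(s.+1, 2))%N by rewrite bin2 divn2 mulnC.
by split=> -[s]; [case=> ->|move=> ->]; exists s; rewrite E.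
Qed.

Lemma leq_bin2 s : (s <= 'C(s.+1, 2))%N.
Proof. by rewrite binS bin1 leq_addl. Qed.

Lemma bin2_inj s t : 'C(s.+1, 2) = 'C(t.+1, 2) -> s = t.
Proof.
by move=> e; have := bin2_double s; have := bin2_double t; rewrite e; nia.
Qed.

(** With [m = t + 1] this is [m(3m-1)/2], and the even case below is [m(3m+1)/2], both written as
    the exponents in Shanks' sum. *)
Lemma gpent_odd t : gpent t.*2.+1 = (t.+1 * t + 'C(t.+2, 2))%N.
Proof.
rewrite /gpent /= odd_double /= -[RHS](@mulKn _ 16) //.
by congr (_ %/ _)%N; have := bin2_double t.+1; nia.
Qed.

Lemma gpent_even t : gpent t.*2.+2 = (t.+1 * t.+1 + 'C(t.+2, 2))%N.
Proof.
rewrite /gpent /= odd_double /= -[RHS](@mulKn _ 16) //.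
by congr (_ %/ _)%N; have := bin2_double t.+1; nia.
Qed.

Lemma leq_gpent j : (j <= gpent j)%N.
Proof.
rewrite -[j]odd_double_half; case: (odd j); last first.
  rewrite add0n; case: (j./2) => // t; rewrite doubleS gpent_even.
  by have := leq_bin2 t.+1; nia.
by rewrite add1n gpent_odd; have := leq_bin2 (j./2).+1; nia.
Qed.

(** * The identities in characteristic 2 *)

Section Characteristic2.
Variable R : comNzRingType.
Hypothesis charR2 : 2%N \in [pchar R].

Let charP2 : 2%N \in [pchar {poly R}].
Proof. by rewrite pchar_poly. Qed.

Lemma sqr_1B_pchar2 (x : {poly R}) : (1 - x) ^+ 2 = 1 - x ^+ 2.
Proof.
by rewrite -[RHS]addr0 -(addrr_pchar2 charP2 (x ^+ 2 - x)); ring.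
Qed.

Lemma pentagonal_pchar2 n :
  congrX n.+1 (eulerp R n ^+ 4) (\sum_(0 <= j < n.*2.+1) 'X^(4 * gpent j)).
Proof.
have -> : eulerp R n ^+ 4 = \prod_(0 <= i < n) (1 - ('X^4) ^+ i.+1).
  rewrite -prodrXl; apply: eq_bigr => i _.
  by rewrite -exprM mulnC exprM (exprM _ 2 2) !sqr_1B_pchar2 -(exprM _ 2 2).
(* The index [j = 0] gives 1, each [t] accounts for [j = 2t+1] and [j = 2t+2], and signs
   disappear. *)
have -> : \sum_(0 <= j < n.*2.+1) 'X^(4 * gpent j) =
    1 + \sum_(0 <= t < n) (-1) ^+ t.+1 *
      (('X^4) ^+ (t.+1 * t + 'C(t.+2, 2)) +
       ('X^4) ^+ (t.+1 * t.+1 + 'C(t.+2, 2))) :> {poly R}.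
  elim: n => [|n IHn]; first by rewrite big_nat1 big_geq // addr0.
  rewrite doubleS (big_nat_recr n.*2.+2) //= (big_nat_recr n.*2.+1) //= IHn.
  rewrite [in RHS]big_nat_recr //= (oppr_pchar2 charP2) expr1n mul1r.
  by rewrite gpent_odd gpent_even !exprM !addrA.
exact: pentagonal_congr.
Qed.

(** The fourth power is [A * A] with [A] the even product. Gauss turns one [A] into [B] times the
    triangular sum, and [A * B] is the Euler product of length [2n]. Keeping a factor [eulerp R n]
    on the right avoids a division; [partp] cancels it later. *)
Lemma gauss_pchar2 n : (0 < n)%N ->
  congrX n.+1 (eulerp R n ^+ 4)
    (eulerp R n * \sum_(0 <= s < n.*2) 'X^('C(s.+1, 2))).
Proof.
move=> n_gt0; pose A := \prod_(0 <= i < n) (1 - 'X^(i.+1.*2)) : {poly R}.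
pose B := \prod_(0 <= i < n) (1 - 'X^(i.*2.+1)) : {poly R}.
have EA : eulerp R n ^+ 2 = A.
  rewrite -prodrXl; apply: eq_bigr => i _.
  by rewrite sqr_1B_pchar2 -exprM muln2.
have EAB : A * B = eulerp R n.*2.
  rewrite /A /B /eulerp; elim: (n) => [|k IHk].
    by rewrite !big_geq ?mulr1.
  rewrite doubleS (big_nat_recr k.*2.+1) //= (big_nat_recr k.*2) //= -IHk.
  rewrite [\prod_(0 <= i < k.+1) (1 - 'X^(i.+1.*2))]big_nat_recr //=.
  rewrite [\prod_(0 <= i < k.+1) (1 - 'X^(i.*2.+1))]big_nat_recr //= doubleS.
  by ring.
rewrite -[4%N]/(2 * 2)%N exprM EA expr2.
apply: (congrX_trans (p2 := A * (B * \sum_(0 <= s < n.*2) 'X^('C(s.+1, 2))))).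
  apply: congrXM; first exact: congrX_refl.
  by apply: congrX_leq _ (gauss_congr R n_gt0); rewrite ltnS -addnn leq_addr.
rewrite mulrA EAB; apply: congrXM; last exact: congrX_refl.
by apply: eulerp_congr; rewrite -addnn leq_addr.
Qed.

Lemma partp_pentagonal_pchar2 n : (0 < n)%N ->
  congrX n.+1 (partp R n * \sum_(0 <= j < n.*2.+1) 'X^(4 * gpent j))
    (\sum_(0 <= s < n.*2) 'X^('C(s.+1, 2))).
Proof.
move=> n_gt0; apply: (congrX_trans (p2 := partp R n * (eulerp R n *
    \sum_(0 <= s < n.*2) 'X^('C(s.+1, 2))))).
  apply: congrXM; first exact: congrX_refl.
  exact: congrX_trans (congrX_sym (pentagonal_pchar2 n)) (gauss_pchar2 n_gt0).
rewrite mulrA -[X in congrX _ _ X]mul1r.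
by apply: congrXM; [exact: partp_eulerp|exact: congrX_refl].
Qed.

End Characteristic2.

(** * Comparison of the coefficients of [X^k] *)

Lemma partZ_subn (k m : nat) :
  partZ (k%:Z - m%:Z) = if (k < m)%N then 0%N else Defs.partn (k - m).
Proof.
case: ltnP => [km|mk]; last by rewrite subzn.
by have -> : k%:Z - m%:Z = Negz (m - k).-1 by lia.
Qed.

(* The sum over j >= 0 has only finitely many nonzero terms (pi_j >= j, so
   terms with j >= N vanish when n < N); we state it for every truncation
   N with n < N. *)
Theorem theorem7 (n : int) (N : nat) : n < N%:Z ->
  (odd (\sum_(j < N) partZ (n - 4 * (gpent j)%:Z)) <-> triangular n).
Proof.
(* For negative [n] all terms vanish and [n] is not triangular. *)
case: n => [k|k] kN; last first.
  split=> [|[s //]]; rewrite big1 // => j _.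
  by have -> : Negz k - 4 * (gpent j)%:Z = Negz (k + 4 * gpent j) by lia.
have {}kN : (k < N)%N by lia.
pose a (j : nat) := partZ (k%:Z - 4 * (gpent j)%:Z).
have aE j :
    a j = if (k < 4 * gpent j)%N then 0%N else Defs.partn (k - 4 * gpent j).
  by rewrite /a -partZ_subn PoszM.
have a0 j : (N <= j)%N -> a j = 0%N.
  by move=> Nj; rewrite aE ifT //; have := leq_gpent j; lia.
have F2 : 2%N \in [pchar 'F_2] by exact: pchar_Fp.
(* The sum is padded with zero terms to the length [2N + 1] of the polynomial congruence. *)
have -> : (\sum_(j < N) partZ (k%:Z - 4 * (gpent j)%:Z)
           = \sum_(0 <= j < N.*2.+1) a j)%N.
  rewrite [RHS](big_cat_nat (n := N)) //=; last by lia.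
  rewrite [X in (_ + X)%N]big_nat [X in (_ + X)%N]big1; last first.
    by move=> j /andP[Nj _]; exact: a0.
  by rewrite addn0 big_mkord.
have N_gt0 : (0 < N)%N by apply: leq_ltn_trans kN.
have coef_k :=
  congrX_coef (partp_pentagonal_pchar2 F2 N_gt0) (ltnW kN : k < N.+1)%N.
rewrite mulr_sumr !coef_sum in coef_k.
have sumE : (\sum_(0 <= j < N.*2.+1) a j)%:R =
    \sum_(0 <= s < N.*2) (k == 'C(s.+1, 2))%:R :> 'F_2.
  under [RHS]eq_bigr do rewrite -coefXn.
  rewrite -coef_k natr_sum; apply: eq_bigr => j _.
  rewrite coefMXn aE; case: ltnP => // _.
  by rewrite coef_partp // (leq_trans (leq_subr _ _)) // ltnW.
have -> : odd (\sum_(0 <= j < N.*2.+1) a j)%N =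
    (\sum_(0 <= s < N.*2) (k == 'C(s.+1, 2))%:R != 0 :> 'F_2).
  by rewrite -sumE -(dvdn_pcharf F2) dvdn2 negbK.
rewrite triangularP; split=> [|[s ks]].
  have [/existsP[s /eqP ks] _|/existsPn no_s] :=
    boolP [exists s : 'I_N.*2, k == 'C(s.+1, 2)]; first by exists s.
  by rewrite big_mkord big1 ?eqxx // => s _; rewrite (negPf (no_s s)).
have s_lt : (s < N.*2)%N by have := leq_bin2 s; lia.
(* Triangular numbers are distinct for distinct indices, so exactly one term is 1. *)
rewrite big_mkord (bigD1 (Ordinal s_lt)) //= ks eqxx big1 ?addr0 ?oner_neq0 //.
move=> t /eqP t_ne; case: eqP => // /bin2_inj st.
by case: t_ne; apply: val_inj.
Qed.
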